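(* Let $X, Y\subset\mathbb{R}^d$ be finite (non-empty) sets and let $\kappa(x,y)$ be a real-valued function defined on $X\times Y$. For any non-empty subsets $S_1\subseteq X$ and $S_2\subseteq Y$, put $\mathcal{X}=X\times Y$, $\mathcal{S}=S_1\times S_2$ and $r_i=\operatorname{card}(S_i)$ for $i=1,2$. Then $$\| K_{XY}-K_{XS_2}K_{S_1S_2}^{+}K_{S_1Y}\|_{\max}\le C_1\,\delta_{X,S_1}+C_2\,\delta_{Y,S_2}+C_3\,\delta_{X,S_1}\delta_{Y,S_2},$$ where $$C_1=L(\mathcal{X},\mathcal{S})+\sqrt{r_2}\,L(X,S_1)_{S_2},\qquad C_2=L(\mathcal{X},\mathcal{S})+\sqrt{r_1}\,L(Y,S_2)_{S_1},$$ $$C_3=\|K_{S_1S_2}^{+}\|\sqrt{r_1r_2}\,L(X,S_1)_{S_2}\,L(Y,S_2)_{S_1}.$$ Furthermore, if $\kappa$ is Lipschitz continuous with Lipschitz constant $L$ on a set $D_1\times D_2$ containing $X\times Y$, then $$\| K_{XY}-K_{XS_2}K_{S_1S_2}^{+}K_{S_1Y}\|_{\max}\le (1+\sqrt{r_2})L\,\delta_{X,S_1}+(1+\sqrt{r_1})L\,\delta_{Y,S_2}+\|K_{S_1S_2}^{+}\|\sqrt{r_1r_2}\,L^2\,\delta_{X,S_1}\delta_{Y,S_2}.$$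
   Context: For finite sets $A\subseteq X$, $B\subseteq Y$, $K_{AB}$ denotes the matrix with entries $\kappa(a,b)$, rows indexed by $a\in A$ and columns by $b\in B$. $M^{+}$ is the Moore–Penrose pseudoinverse, $\|\cdot\|$ is the (spectral) 2-norm, $\|M\|_{\max}$ is the maximum absolute value of the entries of $M$, and $|\cdot|$ is the Euclidean norm on $\mathbb{R}^d$ (absolute value for scalars). For finite sets $S\subseteq Z$, $S\ne\emptyset$, $\delta_{Z,S}:=\max_{x\in Z}\operatorname{dist}(x,S)$ with $\operatorname{dist}(x,S)=\min_{s\in S}|x-s|$. Discrete Lipschitz constants: for non-empty subsets $\mathcal{Z}=Z_1\times Z_2$, $\mathcal{S}=S_1\times S_2$, $W_1\times W_2$ of $X\times Y$, $$L(\mathcal{Z},\mathcal{S}):=\min\{C\ge 0: |\kappa(x,y)-\kappa(u,v)|^2\le C^2(|x-u|^2+|y-v|^2)\ \ \forall (x,y)\in\mathcal{Z},\,(u,v)\in\mathcal{S}\},$$ $$L(Z_2,S_2)_{W_1}:=\min\{C\ge 0: |\kappa(x,y)-\kappa(x,v)|^2\le C^2|y-v|^2\ \ \forall x\in W_1,\,y\in Z_2,\,v\in S_2\},$$ $$L(Z_1,S_1)_{W_2}:=\min\{C\ge 0: |\kappa(x,y)-\kappa(u,y)|^2\le C^2|x-u|^2\ \ \forall y\in W_2,\,x\in Z_1,\,u\in S_1\}.$$ Here $D_1,D_2\subseteq\mathbb{R}^d$, and Lipschitz continuity of $\kappa$ on $D_1\times D_2$ with constant $L$ means $|\kappa(x,y)-\kappa(u,v)|\le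 L(|x-u|^2+|y-v|^2)^{1/2}$ for all $(x,y),(u,v)\in D_1\times D_2$. *)

(* Defs.v *)
From HB Require Import structures.
From mathcomp Require Import all_boot all_order all_algebra.
From mathcomp Require Import finmap.
From mathcomp Require Import all_classical all_reals all_analysis.

Set Implicit Arguments.
Unset Strict Implicit.
Unset Printing Implicit Defensive.

Import Order.TTheory GRing.Theory Num.Theory.
Import numFieldNormedType.Exports.

Local Open Scope classical_set_scope.
Local Open Scope ring_scope.

(* Points of R^d are column vectors.  The library norm on matrices,
   [`|A| = mx_norm A], is the maximum absolute value of the entries, so the
   Euclidean norm has its own name. *)
Definition enorm (R : realType) (n : nat) (v : 'cV[R]_n) : R :=
  Num.sqrt (\sum_(i < n) v i 0 ^+ 2).

Definition specnorm (R : realType) (m n : nat) (A : 'M[R]_(m, n)) : R :=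
  sup [set enorm (A *m v) | v in [set v : 'cV[R]_n | enorm v <= 1]].

Definition is_moore_penrose (R : realType) (m n : nat)
    (A : 'M[R]_(m, n)) (B : 'M[R]_(n, m)) : Prop :=
  [/\ A *m B *m A = A, B *m A *m B = B,
      (A *m B)^T = A *m B & (B *m A)^T = B *m A].

(* Existence and uniqueness ([mpinvP], [mpinv_unique]) are proved below, so the
   default value 0 is never used.  The library's [pinvmx] is only a generalized
   inverse on the row space. *)
Definition mpinv (R : realType) (m n : nat) (A : 'M[R]_(m, n)) : 'M[R]_(n, m) :=
  xget 0 [set B | is_moore_penrose A B].

(* A finite set coerces to a duplicate-free sequence of its elements, which
   orders the rows and columns. *)
Definition kmx (R : realType) (d : nat) (kappa : 'cV[R]_d -> 'cV[R]_d -> R)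
    (A B : {fset 'cV[R]_d}) : 'M[R]_(#|` A|, #|` B|) :=
  \matrix_(i, j) kappa A`_i B`_j.

(* The infima and the maximum below are attained for the (nonempty) finite sets
   concerned: see [dist_to_min], [fdist_max], [lip_min], [lipl_min] and
   [lipr_min]. *)
Definition dist_to (R : realType) (d : nat) (x : 'cV[R]_d)
    (S : {fset 'cV[R]_d}) : R :=
  inf [set enorm (x - s) | s in [set` S]].

Definition fdist (R : realType) (d : nat) (Z S : {fset 'cV[R]_d}) : R :=
  \big[Num.max/0]_(x <- Z) dist_to x S.

Definition lip (R : realType) (d : nat) (kappa : 'cV[R]_d -> 'cV[R]_d -> R)
    (Z S : {fset 'cV[R]_d * 'cV[R]_d}) : R :=
  inf [set C | 0 <= C /\ forall p q, p \in Z -> q \in S ->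
    `|kappa p.1 p.2 - kappa q.1 q.2| ^+ 2 <=
      C ^+ 2 * (enorm (p.1 - q.1) ^+ 2 + enorm (p.2 - q.2) ^+ 2)].

(* [lipr kappa Z2 S2 W1] is L(Z2, S2)_{W1} and [lipl kappa Z1 S1 W2] is
   L(Z1, S1)_{W2}: the subscript is the range of the frozen variable. *)
Definition lipr (R : realType) (d : nat) (kappa : 'cV[R]_d -> 'cV[R]_d -> R)
    (Z2 S2 W1 : {fset 'cV[R]_d}) : R :=
  inf [set C | 0 <= C /\ forall x y v, x \in W1 -> y \in Z2 -> v \in S2 ->
    `|kappa x y - kappa x v| ^+ 2 <= C ^+ 2 * enorm (y - v) ^+ 2].

Definition lipl (R : realType) (d : nat) (kappa : 'cV[R]_d -> 'cV[R]_d -> R)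
    (Z1 S1 W2 : {fset 'cV[R]_d}) : R :=
  inf [set C | 0 <= C /\ forall y x u, y \in W2 -> x \in Z1 -> u \in S1 ->
    `|kappa x y - kappa u y| ^+ 2 <= C ^+ 2 * enorm (x - u) ^+ 2].

(* [kappa] is a total function, constrained only on D1 x D2. *)
Definition euclidean_lipschitz (R : realType) (d : nat)
    (kappa : 'cV[R]_d -> 'cV[R]_d -> R) (D1 D2 : set 'cV[R]_d) (L : R) : Prop :=
  forall x y u v, D1 x -> D2 y -> D1 u -> D2 v ->
    `|kappa x y - kappa u v| <=
      L * Num.sqrt (enorm (x - u) ^+ 2 + enorm (y - v) ^+ 2).

Lemma enorm_ge0 (R : realType) n (v : 'cV[R]_n) : 0 <= enorm v.
Proof. exact: sqrtr_ge0. Qed.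

Lemma enorm_sqr (R : realType) n (v : 'cV[R]_n) :
  enorm v ^+ 2 = \sum_(i < n) v i 0 ^+ 2.
Proof. by rewrite sqr_sqrtr // sumr_ge0 // => i _; exact: sqr_ge0. Qed.

Lemma enorm_eq0 (R : realType) n (v : 'cV[R]_n) : enorm v = 0 -> v = 0.
Proof.
move=> v0; apply/colP => i; rewrite mxE; apply/eqP.
have /psumr_eq0P : \sum_(i < n) v i 0 ^+ 2 = 0 by rewrite -enorm_sqr v0 expr0n.
by move=> /(_ (fun i _ => sqr_ge0 _)) /(_ i isT) /eqP; rewrite sqrf_eq0.
Qed.

Lemma mxtrmul_eq0 (R : realType) m n (A : 'M[R]_(m, n)) : A^T *m A = 0 -> A = 0.
Proof.
move=> A0; apply/matrixP => i j; rewrite mxE; apply/eqP.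
have : \sum_k A k j ^+ 2 = 0.
  move/matrixP/(_ j j): A0; rewrite !mxE => A0; rewrite -[RHS]A0.
  by apply: eq_bigr => k _; rewrite mxE expr2.
move/psumr_eq0P => /(_ (fun i _ => sqr_ge0 _)) /(_ i isT) /eqP.
by rewrite sqrf_eq0.
Qed.

Lemma gram_unit (R : realType) m n (A : 'M[R]_(m, n)) :
  row_free A -> A *m A^T \in unitmx.
Proof.
move=> fA; rewrite -row_free_unit; apply/row_freeP.
suff : kermx (A *m A^T) = 0.
  by move/eqP; rewrite kermx_eq0 => /row_freeP.
set N := kermx _.
have NA : (N *m A) *m A^T = 0 by rewrite -mulmxA mulmx_ker.
have : N *m A = 0.
  apply/trmx_inj; rewrite trmx0; apply: mxtrmul_eq0.
  by rewrite trmxK trmx_mul mulmxA NA mul0mx.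
by rewrite -[RHS](mul0mx _ A) => /(row_free_inj fA).
Qed.

Lemma moore_penrose_factor (R : realType) m r n
    (P : 'M[R]_(m, r)) (Q : 'M[R]_(r, n)) :
  row_full P -> row_free Q -> exists B, is_moore_penrose (P *m Q) B.
Proof.
move=> fP fQ; pose G := Q *m Q^T; pose H := P^T *m P.
have uG : G \in unitmx by exact: gram_unit.
have uH : H \in unitmx.
  have := @gram_unit _ _ _ P^T; rewrite trmxK; apply.
  by rewrite /row_free mxrank_tr.
have GT : G^T = G by rewrite trmx_mul trmxK.
have HT : H^T = H by rewrite trmx_mul trmxK.
pose B := Q^T *m invmx G *m (invmx H *m P^T).
have AB : P *m Q *m B = P *m invmx H *m P^T.
  by rewrite /B !mulmxA -(mulmxA P Q) -/G -(mulmxA P G) mulmxV // mulmx1.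
have BA : B *m (P *m Q) = Q^T *m invmx G *m Q.
  by rewrite /B -!mulmxA (mulmxA P^T P Q) -/H (mulmxA (invmx H)) mulVmx ?mul1mx.
exists B; split.
- by rewrite AB -!mulmxA (mulmxA P^T P Q) -/H (mulmxA (invmx H)) mulVmx ?mul1mx.
- rewrite BA /B !mulmxA -(mulmxA _ Q Q^T) -/G -(mulmxA _ G (invmx G)) mulmxV //.
  by rewrite mulmx1.
- by rewrite AB !trmx_mul trmxK trmx_inv HT mulmxA.
- by rewrite BA !trmx_mul trmxK trmx_inv GT mulmxA.
Qed.

Lemma moore_penrose_exists (R : realType) m n (A : 'M[R]_(m, n)) :
  exists B, is_moore_penrose A B.
Proof.
have := moore_penrose_factor (col_base_full A) (row_base_free A).
by rewrite mulmx_base.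
Qed.

Lemma mpinvP (R : realType) m n (A : 'M[R]_(m, n)) :
  is_moore_penrose A (mpinv A).
Proof.
exact: (xgetPex 0 (moore_penrose_exists A)).
Qed.

Lemma moore_penrose_unique (R : realType) m n (A : 'M[R]_(m, n)) B C :
  is_moore_penrose A B -> is_moore_penrose A C -> B = C.
Proof.
move=> [b1 b2 b3 b4] [c1 c2 c3 c4].
have ABC : A *m B = A *m C.
  by rewrite -b3 -{1}c1 -(mulmxA (A *m C)) trmx_mul b3 c3 mulmxA b1.
have BCA : B *m A = C *m A.
  by rewrite -b4 -{1}c1 -!mulmxA mulmxA trmx_mul c4 b4 -!mulmxA (mulmxA A B) b1.
by rewrite -b2 BCA -mulmxA ABC mulmxA c2.
Qed.

Lemma mpinv_unique (R : realType) m n (A : 'M[R]_(m, n)) B :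
  is_moore_penrose A B -> mpinv A = B.
Proof. exact/moore_penrose_unique/mpinvP. Qed.

Lemma dist_to_min (R : realType) d (x : 'cV[R]_d) (S : {fset 'cV[R]_d}) :
  S != fset0 ->
  (exists2 s, s \in S & dist_to x S = enorm (x - s)) /\
  (forall s, s \in S -> dist_to x S <= enorm (x - s)).
Proof.
move=> /fset0Pn[s0 s0S].
have lb s : s \in S -> dist_to x S <= enorm (x - s).
  move=> sS; apply: ge_inf; last by exists s.
  by exists 0 => _ [t _ <-]; exact: enorm_ge0.
split=> //.
pose f (s : S) := enorm (x - val s).
have [s _ smin] := @arg_minP _ _ _ [` s0S]%fset predT f isT.
exists (val s); first exact: valP.
apply/eqP; rewrite eq_le lb ?valP //=; apply: lb_le_inf.
  by exists (enorm (x - s0)), s0.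
by move=> _ [t /= tS <-]; exact: (smin [` tS]%fset).
Qed.

Lemma inf_sqr_min (R : realType) (T : Type) (P : set T) (a b : T -> R) :
  (forall t, P t -> 0 <= b t) ->
  let E := [set C | 0 <= C /\ forall t, P t -> a t <= C ^+ 2 * b t] in
  E !=set0 -> E (inf E) /\ lbound E (inf E).
Proof.
move=> b0 E E0.
have lbE : has_lbound E by exists 0 => C [].
have lbi : lbound E (inf E) by move=> C EC; exact: ge_inf.
have i0 : 0 <= inf E by apply: lb_le_inf => // C [].
split=> //; split=> // t Pt.
have := b0 _ Pt; rewrite le_eqVlt => /orP[/eqP bt0|bt].
  by have [C [_ /(_ _ Pt)]] := E0; rewrite -bt0 !mulr0.
rewrite -ler_pdivrMr //; have [a0|/ltW a0] := leP (a t) 0.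
  by apply: (le_trans (y := 0)); rewrite ?sqr_ge0 // pmulr_lle0 ?invr_gt0.
have ab0 : 0 <= a t / b t by rewrite divr_ge0 // ltW.
rewrite -(sqr_sqrtr ab0) ler_sqr ?nnegrE ?sqrtr_ge0 //.
apply: lb_le_inf => // C [C0 /(_ _ Pt)].
by rewrite -ler_pdivrMr // -{1}(sqr_sqrtr ab0) ler_sqr ?nnegrE ?sqrtr_ge0.
Qed.

Lemma sqr_bound_exists (R : realType) (T : eqType) (s : seq T) (a b : T -> R) :
  (forall t, t \in s -> 0 <= b t) ->
  (forall t, t \in s -> b t = 0 -> a t <= 0) ->
  exists C, 0 <= C /\ forall t, t \in s -> a t <= C ^+ 2 * b t.
Proof.
elim: s => [|t s IH] b0 ab; first by exists 0; split.
have [] := IH; first by move=> u us; apply: b0; rewrite inE us orbT.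
  by move=> u us; apply: ab; rewrite inE us orbT.
move=> C [C0 CP].
have := b0 t (mem_head _ _); rewrite le_eqVlt => /orP[/eqP bt0|bt].
  exists C; split=> // u; rewrite inE => /orP[/eqP ->|]; last exact: CP.
  by rewrite -bt0 mulr0 ab ?mem_head.
pose D := Num.sqrt (`|a t| / b t).
have D0 : 0 <= D by exact: sqrtr_ge0.
exists (C + D); split; first exact: addr_ge0.
move=> u; rewrite inE => /orP[/eqP ->|us].
  apply: (le_trans (ler_norm _)).
  rewrite -ler_pdivrMr // -[leLHS](@sqr_sqrtr _ (`|a t| / b t)); last first.
    by rewrite divr_ge0 // ltW.
  by rewrite ler_sqr ?nnegrE ?addr_ge0 // lerDr.
apply: (le_trans (CP _ us)); apply: ler_wpM2r; last first.
  by rewrite ler_sqr ?nnegrE ?addr_ge0 // lerDl.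
by apply: b0; rewrite inE us orbT.
Qed.

Lemma lip_min (R : realType) d (kappa : 'cV[R]_d -> 'cV[R]_d -> R)
    (Z S : {fset 'cV[R]_d * 'cV[R]_d}) :
  let E := [set C | 0 <= C /\ forall p q, p \in Z -> q \in S ->
    `|kappa p.1 p.2 - kappa q.1 q.2| ^+ 2 <=
      C ^+ 2 * (enorm (p.1 - q.1) ^+ 2 + enorm (p.2 - q.2) ^+ 2)] in
  E (lip kappa Z S) /\ lbound E (lip kappa Z S).
Proof.
pose a (t : ('cV[R]_d * 'cV[R]_d) * ('cV[R]_d * 'cV[R]_d)) :=
  `|kappa t.1.1 t.1.2 - kappa t.2.1 t.2.2| ^+ 2.
pose b (t : ('cV[R]_d * 'cV[R]_d) * ('cV[R]_d * 'cV[R]_d)) :=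
  enorm (t.1.1 - t.2.1) ^+ 2 + enorm (t.1.2 - t.2.2) ^+ 2.
have b0 t : 0 <= b t by rewrite addr_ge0 ?sqr_ge0.
rewrite /lip; set E := [set _ | _].
have EE : E = [set C | 0 <= C /\ forall t, [set` (Z `*` S)%fset] t ->
    a t <= C ^+ 2 * b t].
  apply/seteqP; split=> C [C0 CP]; split=> //.
    by move=> [p q] /=; rewrite in_fsetE => /andP[]; exact: CP.
  by move=> p q pZ qS; apply: (CP (p, q)); rewrite /= in_fsetE pZ.
rewrite EE; apply: inf_sqr_min => // .
apply: (@sqr_bound_exists _ _ (Z `*` S)%fset) => // -[p q] _ /eqP.
rewrite paddr_eq0 ?sqr_ge0 // !sqrf_eq0 /= /a /=.
move=> /andP[/eqP /enorm_eq0 /eqP + /eqP /enorm_eq0 /eqP].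
by rewrite !subr_eq0 => /eqP -> /eqP ->; rewrite subrr normr0 expr0n.
Qed.

Lemma lipr_min (R : realType) d (kappa : 'cV[R]_d -> 'cV[R]_d -> R)
    (Z2 S2 W1 : {fset 'cV[R]_d}) :
  let E := [set C | 0 <= C /\ forall x y v, x \in W1 -> y \in Z2 -> v \in S2 ->
    `|kappa x y - kappa x v| ^+ 2 <= C ^+ 2 * enorm (y - v) ^+ 2] in
  E (lipr kappa Z2 S2 W1) /\ lbound E (lipr kappa Z2 S2 W1).
Proof.
pose a (t : 'cV[R]_d * 'cV[R]_d * 'cV[R]_d) :=
  `|kappa t.1.1 t.1.2 - kappa t.1.1 t.2| ^+ 2.
pose b (t : 'cV[R]_d * 'cV[R]_d * 'cV[R]_d) := enorm (t.1.2 - t.2) ^+ 2.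
have b0 t : 0 <= b t by rewrite sqr_ge0.
rewrite /lipr; set E := [set _ | _].
have EE : E = [set C | 0 <= C /\ forall t, [set` (W1 `*` Z2 `*` S2)%fset] t ->
    a t <= C ^+ 2 * b t].
  apply/seteqP; split=> C [C0 CP]; split=> //.
    move=> [[x y] v] /=; rewrite !in_fsetE /= => /andP[/andP[]]; exact: CP.
  by move=> x y v xW yZ vS; apply: (CP (x, y, v)); rewrite /= !in_fsetE /= xW yZ.
rewrite EE; apply: inf_sqr_min => // .
apply: (@sqr_bound_exists _ _ (W1 `*` Z2 `*` S2)%fset) => // -[[x y] v] _ /eqP.
rewrite sqrf_eq0 /= => /eqP /enorm_eq0 /eqP; rewrite subr_eq0 => /eqP yv.
by rewrite /a /= yv subrr normr0 expr0n.
Qed.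

Lemma lipl_min (R : realType) d (kappa : 'cV[R]_d -> 'cV[R]_d -> R)
    (Z1 S1 W2 : {fset 'cV[R]_d}) :
  let E := [set C | 0 <= C /\ forall y x u, y \in W2 -> x \in Z1 -> u \in S1 ->
    `|kappa x y - kappa u y| ^+ 2 <= C ^+ 2 * enorm (x - u) ^+ 2] in
  E (lipl kappa Z1 S1 W2) /\ lbound E (lipl kappa Z1 S1 W2).
Proof. exact: (lipr_min (fun y x => kappa x y) Z1 S1 W2). Qed.

Lemma fdist_max (R : realType) d (Z S : {fset 'cV[R]_d}) :
  Z != fset0 -> S != fset0 ->
  (exists2 x, x \in Z & fdist Z S = dist_to x S) /\
  (forall x, x \in Z -> dist_to x S <= fdist Z S).
Proof.
move=> /fset0Pn[x0 x0Z] S0.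
have e0 x : 0 <= dist_to x S.
  by have [[s _ ->] _] := dist_to_min x S0; exact: enorm_ge0.
have le x : x \in Z -> dist_to x S <= fdist Z S.
  by move=> xZ; exact: (@Order.TotalTheory.le_bigmax_seq _ _ _ Z 0 x predT).
split=> //; have : 0 <= fdist Z S by exact: le_trans (le _ x0Z).
have [z0|z0 _] := eqVneq (fdist Z S) 0.
  by move=> _; exists x0 => //; apply/eqP; rewrite eq_le le // z0 e0.
suff : fdist Z S = 0 \/ exists2 x, x \in Z & fdist Z S = dist_to x S.
  by case=> // /eqP; rewrite (negPf z0).
rewrite /fdist big_seq.
apply: (big_ind (fun y => y = 0 \/ exists2 x, x \in Z & y = dist_to x S)).
- by left.
- by move=> x y hx hy; case: (leP x y).
- by move=> x xZ; right; exists x.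
Qed.

Lemma specnorm_has_sup (R : realType) m n (A : 'M[R]_(m, n)) :
  has_sup [set enorm (A *m v) | v in [set v : 'cV[R]_n | enorm v <= 1]].
Proof.
split.
  exists (enorm (A *m 0)), 0 => //=; rewrite /enorm big1 ?sqrtr0 // => i _.
  by rewrite mxE expr0n.
exists (Num.sqrt (\sum_i (\sum_j `|A i j|) ^+ 2)) => _ [v /= v1 <-].
rewrite ler_sqrt ?sumr_ge0 // => [|i _]; last exact: sqr_ge0.
apply: ler_sum => i _; rewrite -(real_normK (num_real ((A *m v) i 0))).
rewrite ler_sqr ?nnegrE ?sumr_ge0 // mxE; apply: le_trans (ler_norm_sum _ _ _) _.
apply: ler_sum => j _; rewrite normrM -[leRHS]mulr1 ler_wpM2l //.
rewrite -(ler_sqr (x := `|v j 0|)) ?nnegrE // real_normK ?num_real // expr1n.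
apply: (le_trans (y := enorm v ^+ 2)); last by rewrite expr_le1 ?enorm_ge0.
by rewrite enorm_sqr (bigD1 j) //= lerDl sumr_ge0 // => k _; exact: sqr_ge0.
Qed.

(* Main.v *)
Require Import Defs.
From HB Require Import structures.
From mathcomp Require Import all_boot all_order all_algebra.
From mathcomp Require Import finmap.
From mathcomp Require Import all_classical all_reals all_analysis.
From mathcomp Require Import ring.

Set Implicit Arguments.
Unset Strict Implicit.
Unset Printing Implicit Defensive.

Import Order.TTheory GRing.Theory Num.Theory.
Import numFieldNormedType.Exports.

Local Open Scope ring_scope.

(** Fix [x] in [X] and [y] in [Y], and let [s] in [S1] and [t] in [S2] be the
    sample points nearest to them.  Put [M := K_{S1 S2}], let [a] be row [x] of
    [K_{X S2}] and [b] column [y] of [K_{S1 Y}].  The corresponding entry of the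
    error matrix is [kappa x y - a M^+ b], which is split as

      [(kappa x y - kappa s t) + (M_{st} - a M^+ b)].

    The Lipschitz constant of [kappa] bounds the first bracket by
    [L (delta_X + delta_Y)].  For the second one, [a] and [b] are regarded as
    perturbations of row [s] and column [t] of [M]; the exact row and column
    would give [M M^+ M = M], so no error at all.  The first-order terms of the
    perturbation see [M^+] only through the orthogonal projections [M^+ M] and
    [M M^+] applied to unit vectors, which is why [||M^+||] appears only in the
    second-order term: this is [moore_penrose_perturbation].  Finally, the
    perturbation of the row has [r2] coordinates, each at most
    [L(X, S1)_{S2} delta_X], hence Euclidean norm at most [sqrt r2] times that,
    and symmetrically for the column; [cross_approximation_bound] collects
    these estimates for arbitrary admissible constants.

    Both parts of the theorem are instances of that lemma, the first for the
    optimal discrete constants and the second for a single constant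
    [L >= 0].  If [L < 0], the Lipschitz condition forces both fill distances to
    be 0, and the second bound coincides with the first. *)

(** * Euclidean and spectral norms *)

Lemma enormZ (R : realType) n (c : R) (v : 'cV[R]_n) :
  enorm (c *: v) = `|c| * enorm v.
Proof.
rewrite /enorm -sqrtr_sqr -sqrtrM ?sqr_ge0 // mulr_sumr.
by congr Num.sqrt; apply: eq_bigr => i _; rewrite mxE exprMn.
Qed.

Lemma enorm0 (R : realType) n : enorm (0 : 'cV[R]_n) = 0.
Proof. by rewrite -(scale0r 0) enormZ normr0 mul0r. Qed.

Lemma enorm_delta (R : realType) n (j : 'I_n) :
  enorm (delta_mx j 0 : 'cV[R]_n) = 1.
Proof.
rewrite /enorm (bigD1 j) //= big1 ?addr0 => [|i /negPf ij].
  by rewrite mxE !eqxx expr1n sqrtr1.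
by rewrite mxE ij expr0n.
Qed.

Lemma enorm_le_sqrt_dim (R : realType) n (v : 'cV[R]_n) (c : R) :
  (forall i, `|v i 0| <= c) -> enorm v <= Num.sqrt n%:R * c.
Proof.
(* The case n = 0 is apart because [c] may then be negative. *)
case: n v => [|n] v vc.
  by rewrite /enorm big_ord0 !sqrtr0 mul0r.
have c0 : 0 <= c := le_trans (normr_ge0 _) (vc ord0).
rewrite -[c in leRHS](ger0_norm c0) -sqrtr_sqr -sqrtrM ?ler0n //.
have -> : n.+1%:R * c ^+ 2 = \sum_(i < n.+1) c ^+ 2.
  by rewrite sumr_const card_ord mulr_natl.
rewrite ler_wsqrtr //; apply: ler_sum => i _.
rewrite -(real_normK (num_real (v i 0))).
by rewrite ler_sqr ?nnegrE.
Qed.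

(** Weighted by the ratio of the two norms, the arithmetic-geometric mean
    inequality on each pair of coordinates sums up to the Cauchy-Schwarz
    bound. *)
Lemma dot_le_enorm (R : realType) n (u v : 'cV[R]_n) :
  `|(u^T *m v) 0 0| <= enorm u * enorm v.
Proof.
have [/enorm_eq0 ->|u0] := eqVneq (enorm u) 0.
  by rewrite trmx0 mul0mx mxE normr0 enorm0 mul0r.
have [/enorm_eq0 ->|v0] := eqVneq (enorm v) 0.
  by rewrite mulmx0 mxE normr0 enorm0 mulr0.
set p := enorm u in u0 *; set q := enorm v in v0 *.
have p0 : 0 < p by rewrite lt0r u0 enorm_ge0.
have q0 : 0 < q by rewrite lt0r v0 enorm_ge0.
rewrite mxE; apply: le_trans (ler_norm_sum _ _ _) _.
have -> : p * q = \sum_i (q / (2 * p) * u i 0 ^+ 2 + p / (2 * q) * v i 0 ^+ 2).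
  by rewrite big_split /= -!mulr_sumr -!enorm_sqr -/p -/q; field; rewrite ?u0 ?v0.
apply: ler_sum => i _; rewrite mxE normrM.
rewrite -(real_normK (num_real (u i 0))) -(real_normK (num_real (v i 0))).
set a := `|u i 0|; set b := `|v i 0|.
have -> : q / (2 * p) * a ^+ 2 + p / (2 * q) * b ^+ 2 =
    a * b + (q * a - p * b) ^+ 2 / (2 * p * q) by field; rewrite ?u0 ?v0.
by rewrite lerDl divr_ge0 ?sqr_ge0 // ?mulr_ge0 // ltW.
Qed.

Lemma specnorm_ge0 (R : realType) m n (A : 'M[R]_(m, n)) : 0 <= specnorm A.
Proof.
apply: (le_trans (enorm_ge0 (A *m 0))); apply: (ub_le_sup (specnorm_has_sup A).2).
by exists 0 => //=; rewrite enorm0 ler01.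
Qed.

Lemma enorm_mulmx_le (R : realType) m n (A : 'M[R]_(m, n)) v :
  enorm (A *m v) <= specnorm A * enorm v.
Proof.
have [/enorm_eq0 ->|v0] := eqVneq (enorm v) 0.
  by rewrite mulmx0 !enorm0 mulr0.
have vp : 0 < enorm v by rewrite lt0r v0 enorm_ge0.
rewrite -ler_pdivrMr // mulrC -[(enorm v)^-1]ger0_norm ?invr_ge0 ?enorm_ge0 //.
rewrite -enormZ scalemxAr; apply: (ub_le_sup (specnorm_has_sup A).2).
exists ((enorm v)^-1 *: v) => //=.
by rewrite enormZ ger0_norm ?invr_ge0 ?enorm_ge0 // mulVf.
Qed.

Lemma enorm_sqr_dot (R : realType) n (v : 'cV[R]_n) :
  enorm v ^+ 2 = (v^T *m v) 0 0.
Proof.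
by rewrite enorm_sqr mxE; apply: eq_bigr => i _; rewrite mxE expr2.
Qed.

(** An orthogonal projection does not increase lengths, since
    [|P v|^2 = <v, P v> <= |v| |P v|]. *)
Lemma enorm_projection_le (R : realType) n (P : 'M[R]_n) (v : 'cV[R]_n) :
  P^T = P -> P *m P = P -> enorm (P *m v) <= enorm v.
Proof.
move=> PT PP; have [->|Pv0] := eqVneq (enorm (P *m v)) 0; first exact: enorm_ge0.
have Pvp : 0 < enorm (P *m v) by rewrite lt0r Pv0 enorm_ge0.
rewrite -(ler_pM2r Pvp) -expr2 enorm_sqr_dot trmx_mul PT -mulmxA (mulmxA P) PP.
exact: le_trans (ler_norm _) (dot_le_enorm _ _).
Qed.

(** * Perturbation of a row and a column of a matrix *)

(** Write [a^T = row i A + u^T] and [b = col j A + v].  Since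
    [row i A = e_i^T A] and [col j A = A e_j], the product [a^T B b] expands
    into [A i j] (from [A B A = A]), the two terms [u^T (B A) e_j] and
    [e_i^T (A B) v] in which orthogonal projections act on unit vectors, so
    that the norm of [B] does not enter, and the term [u^T B v]. *)
Lemma moore_penrose_perturbation (R : realType) m n
    (A : 'M[R]_(m, n)) (B : 'M[R]_(n, m)) i j (a : 'cV[R]_n) (b : 'cV[R]_m) :
  is_moore_penrose A B ->
  `|A i j - (a^T *m B *m b) 0 0| <=
    enorm (a - (row i A)^T) + enorm (b - col j A)
    + specnorm B * enorm (a - (row i A)^T) * enorm (b - col j A).
Proof.
move=> [ABA BAB ABT BAT].
set u := a - _; set v := b - _.
set da := enorm u; set db := enorm v.
pose ei : 'cV[R]_m := delta_mx i 0; pose ej : 'cV[R]_n := delta_mx j 0.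
have rowA : row i A = ei^T *m A by rewrite rowE trmx_delta.
have aE : a^T = u^T + ei^T *m A by rewrite -rowA linearB /= trmxK subrK.
have bE : b = v + A *m ej by rewrite -colE subrK.
have eABA : ei^T *m A *m B *m A = ei^T *m A.
  by rewrite -!mulmxA (mulmxA A) ABA.
have AE : (ei^T *m A *m ej) 0 0 = A i j by rewrite -rowA -colE !mxE.
pose w1 := u^T *m (B *m v); pose w2 := u^T *m (B *m A *m ej).
pose w3 := (A *m B *m ei)^T *m v.
have -> : a^T *m B *m b = w1 + w2 + w3 + ei^T *m A *m ej.
  rewrite aE bE /w1 /w2 /w3 trmx_mul ABT; clearbody u v.
  by rewrite !mulmxDl !mulmxDr !mulmxA !addrA eABA.
have -> : A i j - (w1 + w2 + w3 + ei^T *m A *m ej) 0 0 =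
    - (w2 0 0 + w3 0 0 + w1 0 0).
  rewrite -AE; move: w1 w2 w3 (_ *m ej) => x y z t.
  by rewrite !mxE; ring.
rewrite normrN.
have h1 : `|w1 0 0| <= specnorm B * da * db.
  apply: le_trans (dot_le_enorm _ _) _; rewrite -mulrA mulrCA.
  by rewrite ler_wpM2l ?enorm_ge0 ?enorm_mulmx_le.
have h2 : `|w2 0 0| <= da.
  apply: le_trans (dot_le_enorm _ _) _.
  rewrite -[leRHS]mulr1 ler_wpM2l ?enorm_ge0 // -(enorm_delta R j).
  by apply: enorm_projection_le => //; rewrite mulmxA BAB.
have h3 : `|w3 0 0| <= db.
  apply: le_trans (dot_le_enorm _ _) _.
  rewrite -[leRHS]mul1r ler_wpM2r ?enorm_ge0 // -(enorm_delta R i).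
  by apply: enorm_projection_le => //; rewrite mulmxA ABA.
apply: le_trans (ler_normD _ _) _; apply: lerD => //.
by apply: le_trans (ler_normD _ _) _; apply: lerD.
Qed.

(** * Error of the cross approximation *)

Lemma sqrt_sumsq_le (R : realType) (a b : R) :
  0 <= a -> 0 <= b -> Num.sqrt (a ^+ 2 + b ^+ 2) <= a + b.
Proof.
move=> a0 b0; rewrite -[leRHS]ger0_norm ?addr_ge0 // -sqrtr_sqr ler_wsqrtr //.
by rewrite sqrrD lerD2r lerDl mulrn_wge0 // mulr_ge0.
Qed.

Lemma sqr_le_mul (R : realType) (a C b : R) :
  0 <= C -> 0 <= b -> `|a| ^+ 2 <= C ^+ 2 * b ^+ 2 -> `|a| <= C * b.
Proof. by move=> C0 b0; rewrite -exprMn ler_sqr ?nnegrE ?mulr_ge0. Qed.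

Lemma nearest_point (R : realType) d (Z S : {fset 'cV[R]_d}) x :
  S != fset0 -> x \in Z -> exists2 s, s \in S & enorm (x - s) <= fdist Z S.
Proof.
move=> S0 xZ; have [[s sS xs] _] := dist_to_min x S0.
exists s; rewrite // -xs; have Z0 : Z != fset0 by apply/fset0Pn; exists x.
exact: (fdist_max Z0 S0).2.
Qed.

Lemma fdist_ge0 (R : realType) d (Z S : {fset 'cV[R]_d}) : 0 <= fdist Z S.
Proof. exact: bigmax_ge_id. Qed.

Lemma fdist_eq0 (R : realType) d (Z S : {fset 'cV[R]_d}) :
  Z != fset0 -> S != fset0 ->
  (forall x s, x \in Z -> s \in S -> enorm (x - s) = 0) -> fdist Z S = 0.
Proof.
move=> Z0 S0 ZS; have [[x xZ ->] _] := fdist_max Z0 S0.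
by have [[s sS ->] _] := dist_to_min x S0; exact: ZS.
Qed.

(** If [s] and [t] are the sample points nearest to [x] and [y], row [x] of the
    first factor and column [y] of the last one differ from row [s] and column
    [t] of the core matrix by vectors with [#|` S2|] and [#|` S1|] coordinates,
    each controlled by a one-variable Lipschitz constant. *)
Lemma cross_approximation_bound (R : realType) d
    (kappa : 'cV[R]_d -> 'cV[R]_d -> R) (X Y S1 S2 : {fset 'cV[R]_d})
    (L0 L1 L2 : R) :
  S1 != fset0 -> S2 != fset0 -> 0 <= L0 -> 0 <= L1 -> 0 <= L2 ->
  (forall x y u v, x \in X -> y \in Y -> u \in S1 -> v \in S2 ->
    `|kappa x y - kappa u v| <=
      L0 * Num.sqrt (enorm (x - u) ^+ 2 + enorm (y - v) ^+ 2)) ->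
  (forall y x u, y \in S2 -> x \in X -> u \in S1 ->
    `|kappa x y - kappa u y| <= L1 * enorm (x - u)) ->
  (forall x y v, x \in S1 -> y \in Y -> v \in S2 ->
    `|kappa x y - kappa x v| <= L2 * enorm (y - v)) ->
  mx_norm (kmx kappa X Y
           - kmx kappa X S2 *m mpinv (kmx kappa S1 S2) *m kmx kappa S1 Y) <=
    (L0 + Num.sqrt #|` S2|%:R * L1) * fdist X S1
    + (L0 + Num.sqrt #|` S1|%:R * L2) * fdist Y S2
    + specnorm (mpinv (kmx kappa S1 S2)) * Num.sqrt (#|` S1|%:R * #|` S2|%:R)
      * L1 * L2 * fdist X S1 * fdist Y S2.
Proof.
move=> S1n S2n L0n L1n L2n H0 H1 H2.
set Kp := mpinv _; set r1 : R := #|` S1|%:R; set r2 : R := #|` S2|%:R.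
have dX0 := fdist_ge0 X S1; have dY0 := fdist_ge0 Y S2.
set dX := fdist X S1 in dX0 *; set dY := fdist Y S2 in dY0 *.
have s0 := specnorm_ge0 Kp.
rewrite mx_normrE; apply: bigmax_le => [|[i j] _ /=].
  by rewrite !addr_ge0 // !mulr_ge0 ?addr_ge0 ?mulr_ge0 ?sqrtr_ge0.
set x := X`_i; set y := Y`_j.
have xX : x \in X by exact: mem_nth.
have yY : y \in Y by exact: mem_nth.
have [s sS xs] := nearest_point S1n xX; have [t tS yt] := nearest_point S2n yY.
have si : (index s S1 < #|` S1|)%N by rewrite index_mem.
have ti : (index t S2 < #|` S2|)%N by rewrite index_mem.
pose p := Ordinal si; pose q := Ordinal ti.
pose M := kmx kappa S1 S2.
have Mst : M p q = kappa s t by rewrite mxE !nth_index.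
pose a := (row i (kmx kappa X S2))^T; pose b := col j (kmx kappa S1 Y).
have -> : (kmx kappa X Y - kmx kappa X S2 *m Kp *m kmx kappa S1 Y) i j =
    (kappa x y - kappa s t) + (M p q - (a^T *m Kp *m b) 0 0).
  rewrite Mst addrA subrK trmxK /b colE mulmxA -!row_mul -colE.
  by rewrite [LHS]mxE [X in X + _ = _]mxE [X in _ + X = _]mxE 2![in RHS]mxE.
have da : enorm (a - (row p M)^T) <= Num.sqrt r2 * (L1 * dX).
  apply: enorm_le_sqrt_dim => k; rewrite !mxE (nth_index _ sS).
  by apply: le_trans (H1 _ _ _ _ xX sS) _; rewrite ?mem_nth // ler_wpM2l.
have db : enorm (b - col q M) <= Num.sqrt r1 * (L2 * dY).
  apply: enorm_le_sqrt_dim => k; rewrite !mxE (nth_index _ tS).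
  by apply: le_trans (H2 _ _ _ _ yY tS) _; rewrite ?mem_nth // ler_wpM2l.
have h0 : `|kappa x y - kappa s t| <= L0 * (dX + dY).
  apply: le_trans (H0 _ _ _ _ xX yY sS tS) _; rewrite ler_wpM2l //.
  by apply: le_trans (sqrt_sumsq_le _ _) _; rewrite ?enorm_ge0 ?lerD.
have h1 := moore_penrose_perturbation p q a b (mpinvP M).
apply: le_trans (ler_normD _ _) _; apply: le_trans (lerD h0 h1) _.
apply: (@le_trans _ _ (L0 * (dX + dY) + (Num.sqrt r2 * (L1 * dX)
    + Num.sqrt r1 * (L2 * dY) + specnorm Kp * (Num.sqrt r2 * (L1 * dX))
      * (Num.sqrt r1 * (L2 * dY))))).
  rewrite lerD2l; apply: lerD; first exact: lerD.
  by rewrite -[leLHS]mulrA -[leRHS]mulrA ler_wpM2l // ler_pM ?enorm_ge0.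
by rewrite sqrtrM ?ler0n // le_eqVlt; apply/orP; left; apply/eqP; ring.
Qed.

Theorem theorem2p3 (R : realType) (d : nat)
    (X Y : {fset 'cV[R]_d}) (kappa : 'cV[R]_d -> 'cV[R]_d -> R)
    (S1 S2 : {fset 'cV[R]_d}) :
  X != fset0 -> Y != fset0 ->
  S1 != fset0 -> S2 != fset0 ->
  (S1 `<=` X)%fset -> (S2 `<=` Y)%fset ->
  let XX := (X `*` Y)%fset in
  let SS := (S1 `*` S2)%fset in
  let r1 : R := #|` S1|%:R in
  let r2 : R := #|` S2|%:R in
  let Kp := mpinv (kmx kappa S1 S2) in
  let E := kmx kappa X Y - kmx kappa X S2 *m Kp *m kmx kappa S1 Y in
  let C1 := lip kappa XX SS + Num.sqrt r2 * lipl kappa X S1 S2 in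
  let C2 := lip kappa XX SS + Num.sqrt r1 * lipr kappa Y S2 S1 in
  let C3 := specnorm Kp * Num.sqrt (r1 * r2) *
            lipl kappa X S1 S2 * lipr kappa Y S2 S1 in
  mx_norm E <= C1 * fdist X S1 + C2 * fdist Y S2
               + C3 * fdist X S1 * fdist Y S2
  /\
  forall (D1 D2 : set 'cV[R]_d) (L : R),
    ([set` XX] `<=` D1 `*` D2)%classic ->
    euclidean_lipschitz kappa D1 D2 L ->
    mx_norm E <= (1 + Num.sqrt r2) * L * fdist X S1
                 + (1 + Num.sqrt r1) * L * fdist Y S2
                 + specnorm Kp * Num.sqrt (r1 * r2) * L ^+ 2
                   * fdist X S1 * fdist Y S2.
Proof.
move=> X0 Y0 S10 S20 S1X S2Y XX SS r1 r2 Kp E C1 C2 C3.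
have lipschitz_le := cross_approximation_bound S10 S20.
have first_bound :
    mx_norm E <= C1 * fdist X S1 + C2 * fdist Y S2
                 + C3 * fdist X S1 * fdist Y S2.
  have [[l0 lP] _] := lip_min kappa XX SS.
  have [[ll0 llP] _] := lipl_min kappa X S1 S2.
  have [[lr0 lrP] _] := lipr_min kappa Y S2 S1.
  apply: lipschitz_le => //.
  - move=> x y u v xX yY uS vS; apply: sqr_le_mul; rewrite ?sqrtr_ge0 //.
    rewrite sqr_sqrtr ?addr_ge0 ?sqr_ge0 //.
    by apply: (lP (x, y) (u, v)); rewrite in_fsetE /= ?xX ?uS.
  - move=> y x u yS xX uS.
    by apply: sqr_le_mul; rewrite ?enorm_ge0 //; exact: llP.
  - move=> x y v xS yY vS.
    by apply: sqr_le_mul; rewrite ?enorm_ge0 //; exact: lrP.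
split=> // D1 D2 L XYD kL.
have inX x : x \in X -> D1 x.
  move=> xX; have [y yY] := fset0Pn _ Y0.
  by have [] := XYD (x, y); first by rewrite /= in_fsetE /= xX.
have inY y : y \in Y -> D2 y.
  move=> yY; have [x xX] := fset0Pn _ X0.
  by have [] := XYD (x, y); first by rewrite /= in_fsetE /= xX.
have inS1 u : u \in S1 -> D1 u by move=> uS; exact/inX/(fsubsetP S1X).
have inS2 v : v \in S2 -> D2 v by move=> vS; exact/inY/(fsubsetP S2Y).
have [L0|L0] := leP 0 L.
  rewrite !mulrDl !mul1r expr2 !mulrA -!mulrDl -/r1.
  apply: lipschitz_le => //.
  - by move=> x y u v xX yY uS vS; apply: kL; auto.
  - move=> y x u yS xX uS; apply: le_trans (kL _ _ _ _ _ _ _ _) _; auto.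
    by rewrite subrr enorm0 expr0n addr0 sqrtr_sqr ger0_norm ?enorm_ge0.
  - move=> x y v xS yY vS; apply: le_trans (kL _ _ _ _ _ _ _ _) _; auto.
    by rewrite subrr enorm0 expr0n add0r sqrtr_sqr ger0_norm ?enorm_ge0.
(* A negative constant forces all distances between [X * Y] and [S1 * S2] to
   vanish, and then both bounds are 0. *)
have dist0 x y u v : x \in X -> y \in Y -> u \in S1 -> v \in S2 ->
    enorm (x - u) = 0 /\ enorm (y - v) = 0.
  move=> xX yY uS vS.
  have := le_trans (normr_ge0 _) (kL x y u v _ _ _ _).
  rewrite nmulr_rge0 // => /(_ (inX _ xX) (inY _ yY) (inS1 _ uS) (inS2 _ vS)).
  move=> sqrt_le0.
  have : Num.sqrt (enorm (x - u) ^+ 2 + enorm (y - v) ^+ 2) == 0.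
    by rewrite eq_le sqrt_le0 sqrtr_ge0.
  rewrite sqrtr_eq0 => sum_le0.
  have : enorm (x - u) ^+ 2 + enorm (y - v) ^+ 2 == 0.
    by rewrite eq_le sum_le0 addr_ge0 ?sqr_ge0.
  by rewrite paddr_eq0 ?sqr_ge0 // !sqrf_eq0 => /andP[/eqP -> /eqP ->].
have [[x xX] [y yY]] := (fset0Pn _ X0, fset0Pn _ Y0).
have [[u uS] [v vS]] := (fset0Pn _ S10, fset0Pn _ S20).
have dX0 : fdist X S1 = 0.
  by apply: fdist_eq0 => // z w zX wS; have [] := dist0 z y w v zX yY wS vS.
have dY0 : fdist Y S2 = 0.
  by apply: fdist_eq0 => // z w zY wS; have [] := dist0 x z u w xX zY uS wS.
by move: first_bound; rewrite dX0 dY0 !mulr0.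
Qed.
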